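(* Fix unit-norm transmit filters $\mathbf g_1,\dots,\mathbf g_S$, unit-norm receive filters $\mathbf u_1,\dots,\mathbf u_S$ and real scaling factors $\alpha_1,\dots,\alpha_S$ as in the context, and let $\mathbf p=[p_1,\dots,p_S]^T$ with all $p_l>0$. Then, for the downlink precoders and decoders $\mathbf B=\mathbf G\mathbf P^{1/2}$, $\mathbf W=\mathbf U\boldsymbol\alpha\mathbf P^{-1/2}$, the AMSE of the $l$th symbol is $$\bar\xi_l^{DL}=p_l^{-1}\big[(\mathbf D+\boldsymbol\alpha^2\mathbf\Phi^T)\mathbf p\big]_l+p_l^{-1}\alpha_l^2\,\mathbf u_l^H\mathbf R_n\mathbf u_l,\qquad l=1,\dots,S,$$ where $\mathbf D$ is the diagonal matrix with $$[\mathbf D]_{l,l}=\alpha_l^2\big(|\mathbf g_l^H\widehat{\mathbf H}\mathbf u_l|^2+\sigma_{ef(l)}^2\|\mathbf R_{mf(l)}^{1/2}\mathbf u_l\|_2^2\,\|\mathbf R_{bf(l)}^{1/2}\mathbf g_l\|_2^2\big)-2\alpha_l\,\mathrm{Re}(\mathbf u_l^H\widehat{\mathbf H}^H\mathbf g_l)+1$$ and $$[\mathbf\Phi]_{l,j}=\begin{cases}|\mathbf g_l^H\widehat{\mathbf H}\mathbf u_j|^2+\sigma_{ef(j)}^2\|\mathbf R_{mf(j)}^{1/2}\mathbf u_j\|_2^2\,\|\mathbf R_{bf(j)}^{1/2}\mathbf g_l\|_2^2,& l\ne j,\\ 0,& l=j.\end{cases}$$ Moreover, each $\bar\xi_l^{DL}$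 is a posynomial in the variables $p_1,\dots,p_S$, so that for any $P_{max}>0$ the power allocation problem $$\min_{p_1,\dots,p_S>0}\ \sum_{l=1}^S\bar\xi_l^{DL}\quad\text{subject to}\quad\sum_{l=1}^Sp_l\le P_{max}$$ is a geometric program.
   Context: Positive integers $N,K$ and $M_k,S_k$ ($k=1,\dots,K$) are given, with $M=\sum_k M_k$, $S=\sum_k S_k$. For each $k$ the following are given: a complex matrix $\widehat{\mathbf H}_k\in\mathbb C^{N\times M_k}$ (estimated channel), a real number $\sigma_{ek}^2\ge 0$, Hermitian positive semidefinite matrices $\mathbf R_{bk}\in\mathbb C^{N\times N}$ and $\mathbf R_{nk}\in\mathbb C^{M_k\times M_k}$, and a Hermitian positive definite matrix $\widetilde{\mathbf R}_{mk}\in\mathbb C^{M_k\times M_k}$, from which $\mathbf R_{mk}=(\mathbf I_{M_k}+\sigma_{ek}^2\widetilde{\mathbf R}_{mk}^{-1})^{-1}$. Put $\widehat{\mathbf H}=[\widehat{\mathbf H}_1,\dots,\widehat{\mathbf H}_K]\in\mathbb C^{N\times M}$ and $\mathbf R_n=\mathrm{blkdiag}(\mathbf R_{n1},\dots,\mathbf R_{nK})$. The downlink precoders are $\mathbf B=[\mathbf B_1,\dots,\mathbf B_K]$ with $\mathbf B_k\in\mathbb C^{N\times S_k}$, and the decoders are $\mathbf W=\mathrm{blkdiag}(\mathbf W_1,\dots,\mathbf W_K)$ with $\mathbf W_k\in\mathbb C^{M_k\times S_k}$. The average MSE (AMSE) matrix of user $k$ is $$\bar{\boldsymbol\xi}_k^{DL}=\mathbf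 I_{S_k}+\mathbf W_k^H\mathbf\Gamma_k^{DL}\mathbf W_k-\mathbf W_k^H\widehat{\mathbf H}_k^H\mathbf B_k-\mathbf B_k^H\widehat{\mathbf H}_k\mathbf W_k,$$ $$\mathbf\Gamma_k^{DL}=\widehat{\mathbf H}_k^H\mathbf B\mathbf B^H\widehat{\mathbf H}_k+\sigma_{ek}^2\mathrm{tr}\{\mathbf R_{bk}\mathbf B\mathbf B^H\}\mathbf R_{mk}+\mathbf R_{nk}.$$ The symbols of all users are numbered consecutively $l=1,\dots,S$ (first those of user 1, then those of user 2, etc.); $f(l)$ is the user to which symbol $l$ belongs, i.e. the smallest $k$ with $\sum_{m=1}^kS_m\ge l$. The AMSE $\bar\xi_l^{DL}$ of symbol $l$ is the corresponding diagonal entry of $\bar{\boldsymbol\xi}_{f(l)}^{DL}$. Decomposition: $\mathbf G=[\mathbf g_1,\dots,\mathbf g_S]\in\mathbb C^{N\times S}$; $\mathbf U=\mathrm{blkdiag}(\mathbf U_1,\dots,\mathbf U_K)=[\mathbf u_1,\dots,\mathbf u_S]\in\mathbb C^{M\times S}$ with $\mathbf U_k\in\mathbb C^{M_k\times S_k}$; $\|\mathbf g_l\|_2=\|\mathbf u_l\|_2=1$; $\mathbf P=\mathrm{diag}(p_1,\dots,p_S)$; $\boldsymbol\alpha=\mathrm{diag}(\alpha_1,\dots,\alpha_S)$ real. In expressions such as $\mathbf R_{mf(l)}^{1/2}\mathbf u_l$, the vector $\mathbf u_l$ is identified with its block in $\mathbb C^{M_{f(l)}}$ (all its other entries are zero).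 A posynomial in positive variables $p_1,\dots,p_S$ is a finite sum of terms $c\,p_1^{a_1}\cdots p_S^{a_S}$ with $c\ge0$ and real exponents $a_i$ (terms with $c=0$ are allowed). A geometric program is the minimization of a posynomial over positive variables subject to constraints of the form (posynomial) $\le 1$ (and possibly monomial equalities). *)

(* Defs.v *)
From HB Require Import structures.
From mathcomp Require Import all_boot all_order all_algebra.
From mathcomp Require Import boolp classical_sets reals exp.
From mathcomp Require Export complex.

Set Implicit Arguments.
Unset Strict Implicit.
Unset Printing Implicit Defensive.

Import Order.TTheory GRing.Theory Num.Theory.

Local Open Scope ring_scope.
Local Open Scope complex_scope.
Local Open Scope sesquilinear_scope.

(** Linear algebra over C = R[i].  A ^t* is the conjugate transpose; an
    inequality 0 <= z in R[i] entails that z is real. *)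

Definition psdmx (R : realType) (n : nat) (A : 'M[R[i]]_n) : Prop :=
  A ^t* = A /\ forall x : 'cV[R[i]]_n, 0 <= (x ^t* *m A *m x) 0 0.

Definition pdmx (R : realType) (n : nat) (A : 'M[R[i]]_n) : Prop :=
  A ^t* = A /\ forall x : 'cV[R[i]]_n, x != 0 -> 0 < (x ^t* *m A *m x) 0 0.

(** The Hermitian positive semidefinite square root A^{1/2}, unique whenever
    A is positive semidefinite; the default 0 is returned only otherwise
    (see sqrtmxP and sqrtmx_unique). *)
Definition sqrtmx (R : realType) (n : nat) (A : 'M[R[i]]_n) : 'M[R[i]]_n :=
  xget 0 [set X | psdmx X /\ X *m X = A]%classic.

Lemma adjmxM (R : realType) m n p (A : 'M[R[i]]_(m, n)) (B : 'M[R[i]]_(n, p)) :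
  (A *m B) ^t* = B ^t* *m A ^t*.
Proof. by rewrite trmx_mul map_mxM. Qed.

Lemma psdmx_adjM (R : realType) m n (A : 'M[R[i]]_(m, n)) : psdmx (A ^t* *m A).
Proof.
split=> [|x]; first by rewrite adjmxM trmxCK.
rewrite !mulmxA -adjmxM -mulmxA mxE sumr_ge0 // => i _.
by rewrite !mxE mulrC mul_conjC_ge0.
Qed.

Lemma adjM_eq0 (R : realType) m n (A : 'M[R[i]]_(m, n)) : \tr (A ^t* *m A) = 0 -> A = 0.
Proof.
move=> h; apply/matrixP => k l; move/eqP: h; rewrite /mxtrace psumr_eq0; last first.
  move=> i _; rewrite mxE sumr_ge0 // => j _; by rewrite !mxE mulrC mul_conjC_ge0.
move=> /allP /(_ l); rewrite mem_index_enum => /(_ isT) /=.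
rewrite mxE psumr_eq0; last by move=> j _; rewrite !mxE mulrC mul_conjC_ge0.
move=> /allP /(_ k); rewrite mem_index_enum => /(_ isT) /=.
by rewrite !mxE mulrC mul_conjC_eq0 => /eqP.
Qed.

Lemma psdmx_sqrt_ex (R : realType) n (A : 'M[R[i]]_n) :
  psdmx A -> exists X, psdmx X /\ X *m X = A.
Proof.
case=> hA pA.
have nA : A \is normalmx by apply/normalmxP; rewrite hA.
have /orthomx_spectralP := nA.
have uP := spectral_unitarymx A; rewrite invmx_unitary //.
set P := spectralmx A in uP *; set d := spectral_diag A => eA.
have PP : P *m P ^t* = 1%:M by apply/unitarymxP.
have d_ge0 i : 0 <= d 0 i.
  have := pA (P ^t* *m delta_mx i 0).
  have eD : P *m A *m P ^t* = diag_mx d.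
    by rewrite eA !mulmxA PP mul1mx -mulmxA PP mulmx1.
  rewrite adjmxM trmxCK !mulmxA -[_ *m P *m A]mulmxA -[_ *m (P *m A) *m _]mulmxA.
  rewrite eD trmx_delta map_delta_mx -rowE -colE mxE.
  by rewrite !mxE eqxx mulr1n.
pose E := diag_mx (map_mx sqrtC d).
have hE : E ^t* = E.
  rewrite tr_diag_mx map_diag_mx -map_mx_comp; congr diag_mx; apply/rowP => i.
  by rewrite !mxE /=; apply/CrealP; rewrite ger0_real ?sqrtC_ge0.
exists (P ^t* *m E *m P); split; last first.
  rewrite !mulmxA -[_ *m P *m P ^t*]mulmxA PP mulmx1 [RHS]eA.
  rewrite -[_ *m E *m E]mulmxA; congr (_ *m _ *m _).
  rewrite mulmx_diag; congr diag_mx; apply/rowP => i.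
  by rewrite !mxE -expr2 sqrtCK.
pose F := diag_mx (map_mx (fun z => sqrtC (sqrtC z)) d).
have hF : F ^t* = F.
  rewrite tr_diag_mx map_diag_mx -map_mx_comp; congr diag_mx; apply/rowP => i.
  by rewrite !mxE /=; apply/CrealP; rewrite ger0_real ?sqrtC_ge0.
suff -> : P ^t* *m E *m P = (F *m P) ^t* *m (F *m P) by exact: psdmx_adjM.
rewrite adjmxM hF mulmxA -[_ *m F *m F]mulmxA; congr (_ *m _ *m _).
rewrite mulmx_diag; congr diag_mx; apply/rowP => i.
by rewrite !mxE -expr2 sqrtCK.
Qed.

Lemma sqrtmxP (R : realType) n (A : 'M[R[i]]_n) :
  psdmx A -> psdmx (sqrtmx A) /\ sqrtmx A *m sqrtmx A = A.
Proof. by move=> /psdmx_sqrt_ex [X hX]; rewrite /sqrtmx; apply: (@xgetPex _ 0 [set X | psdmx X /\ X *m X = A]%classic); exists X. Qed.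

Lemma sqrtmx_unique (R : realType) n (A X : 'M[R[i]]_n) :
  psdmx X -> X *m X = A -> sqrtmx A = X.
Proof.
move=> pX eX.
have pA : psdmx A by rewrite -eX -{1}(proj1 pX); exact: psdmx_adjM.
have [pY eY] := sqrtmxP pA; set Y := sqrtmx A in pY eY *.
have [S [pS eS]] := psdmx_sqrt_ex pX.
have [T [pT eT]] := psdmx_sqrt_ex pY.
pose Z := Y - X.
have hZ : Z ^t* = Z by rewrite /Z linearB /= map_mxB (proj1 pX) (proj1 pY).
have e0 : Y *m Z + Z *m X = 0.
  by rewrite /Z mulmxBr mulmxBl eX eY addrA subrK subrr.
have e1 : \tr ((T *m Z) ^t* *m (T *m Z)) + \tr ((S *m Z) ^t* *m (S *m Z)) = 0.
  rewrite !adjmxM hZ (proj1 pS) (proj1 pT) !mulmxA.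
  rewrite -[Z *m T *m T]mulmxA -[Z *m S *m S]mulmxA eT eS.
  rewrite [X in _ + X]mxtrace_mulC -mxtraceD -[Z *m Y *m Z]mulmxA -mulmxDr e0.
  by rewrite mulmx0 mxtrace0.
have ge0 m (B : 'M[R[i]]_(m, n)) : 0 <= \tr (B ^t* *m B).
  rewrite /mxtrace sumr_ge0 // => i _; rewrite mxE sumr_ge0 // => j _.
  by rewrite !mxE mulrC mul_conjC_ge0.
move/eqP: e1; rewrite paddr_eq0 // => /andP[/eqP /adjM_eq0 TZ /eqP /adjM_eq0 SZ].
have ZZ : Z ^t* *m Z = 0.
  rewrite hZ {1}/Z mulmxBl -eT -eS -!mulmxA TZ SZ !mulmx0 subrr //.
by apply/subr0_eq/adjM_eq0; rewrite ZZ mxtrace0.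
Qed.

(** The library norm of a matrix is the sup norm, hence this definition. *)
Definition norm2 (R : realType) (n : nat) (v : 'cV[R[i]]_n) : R[i] :=
  sqrtC (\sum_i `|v i 0| ^+ 2).

(** Block diagonal matrix with rectangular blocks (mxdiag is limited to square
    ones); conform_mx only transports A i from size (r i, c i) to the equal
    size (r i, c j). *)
Definition blkdiag (R : realType) (K : nat) (r c : 'I_K -> nat)
    (A : forall k, 'M[R[i]]_(r k, c k)) : 'M[R[i]]_(\sum_k r k, \sum_k c k) :=
  \mxblock_(i, j) (if i == j then conform_mx 0 (A i) else 0).

(** diag(p_1 ^ a, ..., p_n ^ a), as a complex matrix *)
Definition diagpow (R : realType) (n : nat) (p : 'cV[R]_n) (a : R) :
    'M[R[i]]_n :=
  diag_mx (\row_l (p l 0 `^ a)%:C).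

Lemma sig1_least K (S : 'I_K -> nat) (l : 'I_(\sum_k S k)) :
  (l < \sum_(m < K | (m <= tagnat.sig1 l)%N) S m)%N /\
  forall k : 'I_K, (l < \sum_(m < K | (m <= k)%N) S m)%N -> (tagnat.sig1 l <= k)%N.
Proof.
have el := tagnat.rect l.
split.
  apply: (@leq_trans (\sum_(m < K | (m < tagnat.sig1 l)%N) S m + S (tagnat.sig1 l))%N).
    by rewrite [ltnLHS]el ltn_add2l.
  rewrite [leqRHS](bigD1 (tagnat.sig1 l)) //= addnC leq_add2l.
  rewrite [leqRHS](eq_bigl (fun m : 'I_K => (m < tagnat.sig1 l)%N)) // => m.
  by rewrite [RHS]ltn_neqAle andbC.
move=> k; rewrite [in X in X -> _]el; apply: contraLR; rewrite -ltnNge -leqNgt => kl.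
apply: leq_trans (leq_addr _ _).
rewrite [leqRHS](bigID (fun m : 'I_K => (m <= k)%N)) /=.
apply: leq_trans (leq_addr _ _).
rewrite [leqRHS](eq_bigl (fun m : 'I_K => (m <= k)%N)) // => m.
by case: (leqP m k) => mk; rewrite ?andbF // (leq_ltn_trans mk kl).
Qed.

(** Downlink channel data.  Rmt k is \widetilde R_{mk}. *)
Record channel (R : realType) (N K : nat) (M : 'I_K -> nat) := Channel {
  Hhat : forall k, 'M[R[i]]_(N, M k);
  sigma2 : 'I_K -> R;
  Rb : 'I_K -> 'M[R[i]]_N;
  Rn : forall k, 'M[R[i]]_(M k);
  Rmt : forall k, 'M[R[i]]_(M k) }.

Section System.
Variables (R : realType) (N K : nat) (M S : 'I_K -> nat).
Variable ch : channel R N M.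
Local Notation C := (R[i]).
Local Notation Mtot := (\sum_k M k)%N.
Local Notation Stot := (\sum_k S k)%N.

Definition Rm k : 'M[C]_(M k) :=
  invmx (1%:M + (sigma2 ch k)%:C *: invmx (Rmt ch k)).

Definition Hfull : 'M[C]_(N, Mtot) := \mxrow_k Hhat ch k.

Definition Rnfull : 'M[C]_Mtot := \mxdiag_k Rn ch k.

Section AMSE.
Variables (B : forall k, 'M[C]_(N, S k)) (W : forall k, 'M[C]_(M k, S k)).

Definition GammaDL k : 'M[C]_(M k) :=
  let Bfull : 'M[C]_(N, Stot) := \mxrow_j B j in
  (Hhat ch k) ^t* *m Bfull *m Bfull ^t* *m Hhat ch k
  + ((sigma2 ch k)%:C * \tr (Rb ch k *m Bfull *m Bfull ^t*)) *: Rm k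
  + Rn ch k.

Definition amse_mx k : 'M[C]_(S k) :=
  1%:M + (W k) ^t* *m GammaDL k *m W k
  - (W k) ^t* *m (Hhat ch k) ^t* *m B k
  - (B k) ^t* *m Hhat ch k *m W k.

(** f(l) is tagnat.sig1 l (see sig1_least) and tagnat.sig2 l is the index of
    symbol l among the symbols of user f(l). *)
Definition amse (l : 'I_Stot) : C :=
  amse_mx (tagnat.sig1 l) (tagnat.sig2 l) (tagnat.sig2 l).

End AMSE.

Section Decomposition.
Variables (G : 'M[C]_(N, Stot)) (U : forall k, 'M[C]_(M k, S k)).
Variables (alpha : 'I_Stot -> R).

(** The block of u_l in C^(M_f(l)); u_l itself is [col l (blkdiag U)]. *)
Definition ublock (l : 'I_Stot) : 'cV[C]_(M (tagnat.sig1 l)) :=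
  col (tagnat.sig2 l) (U (tagnat.sig1 l)).

Definition alphamx : 'M[C]_Stot := diag_mx (\row_l (alpha l)%:C).

(** The blocks B_k of B = G P^(1/2) *)
Definition precoder (p : 'cV[R]_Stot) k : 'M[C]_(N, S k) :=
  submxrow (G *m diagpow p (2^-1)) k.

(** The diagonal blocks W_k of W = U alpha P^(-1/2), which is block diagonal
    (see blkdiag_decoder) *)
Definition decoder (p : 'cV[R]_Stot) k : 'M[C]_(M k, S k) :=
  submxblock (blkdiag U *m alphamx *m diagpow p (- 2^-1)) k k.

(** |g_l^H H u_j|^2
      + sigma_{e f(j)}^2 ||R_{m f(j)}^{1/2} u_j||^2 ||R_{b f(j)}^{1/2} g_l||^2,
    the quantity common to D (with j = l) and Phi (with j != l) *)
Definition coupling (l j : 'I_Stot) : C :=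
  let k := tagnat.sig1 j in
  `|((col l G) ^t* *m Hfull *m col j (blkdiag U)) 0 0| ^+ 2
  + (sigma2 ch k)%:C * norm2 (sqrtmx (Rm k) *m ublock j) ^+ 2
    * norm2 (sqrtmx (Rb ch k) *m col l G) ^+ 2.

Definition Dmx : 'M[C]_Stot :=
  diag_mx (\row_l
    ((alpha l)%:C ^+ 2 * coupling l l
     - 2 * (alpha l)%:C
       * (complex.Re (((col l (blkdiag U)) ^t* *m Hfull ^t* *m col l G) 0 0))%:C
     + 1)).

Definition Phimx : 'M[C]_Stot :=
  \matrix_(l, j) (if l == j then 0 else coupling l j).

End Decomposition.
End System.

Lemma blkdiag_decoder (R : realType) K (M S : 'I_K -> nat)
  (U : forall k, 'M[R[i]]_(M k, S k)) alpha (p : 'cV[R]_(\sum_k S k)) :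
  blkdiag (decoder U alpha p) = blkdiag U *m alphamx alpha *m diagpow p (- 2^-1).
Proof.
apply/mxblockP => i j; rewrite mxblockK.
case: eqP => [<-|/eqP ij]; first by rewrite conform_mx_id.
apply/matrixP => s t; rewrite mxE [RHS]mxE /alphamx /diagpow -mulmxA mulmx_diag mul_mx_diag mxE.
have -> : blkdiag U (tagnat.Rank i s) (tagnat.Rank j t) = 0.
  transitivity (submxblock (blkdiag U) i j s t); first by rewrite [RHS]mxE.
  by rewrite mxblockK (negbTE ij) mxE.
by rewrite mul0r.
Qed.

(** Posynomials and geometric programs *)

Definition pos_orthant (R : realType) (n : nat) (p : 'cV[R]_n) : Prop :=
  forall l, 0 < p l 0.

Definition monomial_eval (R : realType) (n : nat) (c : R) (a : 'I_n -> R)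
    (p : 'cV[R]_n) : R :=
  c * \prod_i (p i 0 `^ a i).

(** Only the values on the positive orthant matter. *)
Definition posynomial (R : realType) (n : nat) (f : 'cV[R]_n -> R) : Prop :=
  exists (m : nat) (c : 'I_m -> R) (a : 'I_m -> 'I_n -> R),
    (forall t, 0 <= c t) /\
    (forall p, pos_orthant p -> f p = \sum_t monomial_eval (c t) (a t) p).

Definition monomial (R : realType) (n : nat) (f : 'cV[R]_n -> R) : Prop :=
  exists (c : R) (a : 'I_n -> R),
    0 < c /\ (forall p, pos_orthant p -> f p = monomial_eval c a p).

Record min_problem (R : realType) (n : nat) := MinProblem {
  objective : 'cV[R]_n -> R;
  feasible : 'cV[R]_n -> Prop }.

Definition geometric_program (R : realType) (n : nat)
    (pb : min_problem R n) : Prop :=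
  posynomial (objective pb) /\
  exists (m r : nat) (q : 'I_m -> 'cV[R]_n -> R) (h : 'I_r -> 'cV[R]_n -> R),
    [/\ forall i, posynomial (q i),
        forall j, monomial (h j) &
        forall p, feasible pb p <->
          [/\ pos_orthant p, forall i, q i p <= 1 & forall j, h j p = 1]].

(* Main.v *)
Require Import Defs.
From HB Require Import structures.
From mathcomp Require Import all_boot all_order all_algebra.
From mathcomp Require Import reals exp.
From mathcomp Require Import ring.

Set Implicit Arguments.
Unset Strict Implicit.
Unset Printing Implicit Defensive.

Import Order.TTheory GRing.Theory Num.Theory.

Local Open Scope ring_scope.
Local Open Scope complex_scope.
Local Open Scope sesquilinear_scope.

(* For b_l = sqrt(p_l) g_l and w_l = (alpha_l / sqrt(p_l)) u_l, the AMSE of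
   symbol l is 1 + w_l^H Gamma w_l - 2 Re (w_l^H H^H b_l), where the powers
   cancel in the cross term and w_l^H Gamma w_l is alpha_l^2 / p_l times
   sum_j p_j coupling(j, l) + u_l^H R_n u_l.  This gives the formula.  The only
   coefficient whose sign is not obvious is that of p_l / p_l, but it is
   |alpha_l g_l^H H u_l - 1|^2 plus a nonnegative estimation error term. *)

(** * Closure properties of posynomials *)

Section Posynomials.
Variables (R : realType) (n : nat).
Implicit Types (f g : 'cV[R]_n -> R) (p : 'cV[R]_n).

(** Transport along [enum_val] frees the index set, so that sums and products of posynomials can be
    indexed by sum and product types. *)
Lemma posynomial_fin (T : finType) (c : T -> R) (a : T -> 'I_n -> R) f :
    (forall t, 0 <= c t) ->
    (forall p, pos_orthant p -> f p = \sum_t monomial_eval (c t) (a t) p) ->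
  posynomial f.
Proof.
move=> c_ge0 fE; exists #|T|, (c \o enum_val), (a \o enum_val).
split=> [t|p /fE->]; first exact: c_ge0.
by rewrite (reindex_onto enum_val enum_rank) => [|t _]; rewrite ?enum_rankK //;
   apply: eq_bigl => t; rewrite enum_valK eqxx.
Qed.

Lemma posynomial_ext f g :
  (forall p, pos_orthant p -> f p = g p) -> posynomial g -> posynomial f.
Proof.
move=> fg [m [c [a [c_ge0 gE]]]]; exists m, c, a; split=> // p p_gt0.
by rewrite fg ?gE.
Qed.

Lemma monomial_posynomial c a :
  0 <= c -> posynomial (fun p : 'cV[R]_n => monomial_eval c a p).
Proof. by move=> c0; exists 1%N, (fun=> c), (fun=> a); split=> // p _; rewrite big_ord1. Qed.

Lemma posynomialD f g :
  posynomial f -> posynomial g -> posynomial (fun p => f p + g p).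
Proof.
move=> [m [c [a [c_ge0 fE]]]] [k [d [b [d_ge0 gE]]]].
apply: (@posynomial_fin ('I_m + 'I_k)%type
  (fun t => match t with inl i => c i | inr j => d j end)
  (fun t => match t with inl i => a i | inr j => b j end)) => [[i|j]|p p_gt0] //.
by rewrite big_sumType fE ?gE.
Qed.

(** Distributivity gives one term for each pair of terms; coefficients multiply and exponents add,
    the latter because each variable is nonzero on the positive orthant. *)
Lemma posynomialM f g :
  posynomial f -> posynomial g -> posynomial (fun p => f p * g p).
Proof.
move=> [m [c [a [c_ge0 fE]]]] [k [d [b [d_ge0 gE]]]].
apply: (@posynomial_fin ('I_m * 'I_k)%type
  (fun t => c t.1 * d t.2) (fun t i => a t.1 i + b t.2 i)) => [t|p p_gt0] //.
  exact: mulr_ge0.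
rewrite fE ?gE // big_distrlr /= pair_big; apply: eq_bigr => -[i j] _ /=.
rewrite /monomial_eval mulrACA -big_split; congr (_ * _).
by apply: eq_bigr => l _ /=; rewrite powRD ?(gt_eqF (p_gt0 l)) ?implybT.
Qed.

Lemma posynomial_const c : 0 <= c -> posynomial (fun _ : 'cV[R]_n => c).
Proof.
move=> c0; apply: posynomial_ext (monomial_posynomial (fun=> 0) c0) => p _.
by rewrite /monomial_eval big1 ?mulr1 // => i _; rewrite powRr0.
Qed.

Lemma posynomial_powR (l : 'I_n) (e : R) : posynomial (fun p => p l 0 `^ e).
Proof.
apply: posynomial_ext (monomial_posynomial (fun i => if i == l then e else 0) ler01).
move=> p _; rewrite /monomial_eval mul1r (bigD1 l) //= eqxx big1 ?mulr1 //.
by move=> i /negPf->; rewrite powRr0.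
Qed.

Lemma posynomial_var (l : 'I_n) : posynomial (fun p => p l 0).
Proof.
by apply: posynomial_ext (posynomial_powR l 1) => p p_gt0; rewrite powRr1 ?ltW.
Qed.

Lemma posynomial_inv (l : 'I_n) : posynomial (fun p => (p l 0)^-1).
Proof.
by apply: posynomial_ext (posynomial_powR l (-1)) => p p_gt0; rewrite powR_inv1 ?ltW.
Qed.

Lemma posynomial_sum (T : Type) (r : seq T) (F : T -> 'cV[R]_n -> R) :
  (forall t, posynomial (F t)) -> posynomial (fun p => \sum_(t <- r) F t p).
Proof.
move=> F_posy; elim: r => [|t r IHr].
  by apply: posynomial_ext (posynomial_const (lexx 0)) => p _; rewrite big_nil.
by apply: posynomial_ext (posynomialD (F_posy t) IHr) => p _; rewrite big_cons.
Qed.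

(** Dividing the budget by [Pmax] gives it the standard form of a posynomial bounded by 1. *)
Lemma power_budget_geometric_program f (Pmax : R) :
    posynomial f -> 0 < Pmax ->
  geometric_program
    (MinProblem f (fun p => pos_orthant p /\ \sum_l p l 0 <= Pmax)).
Proof.
move=> f_posy Pmax_gt0; split=> //=.
(* There is one inequality and no equality; the last witness is an arbitrary family over the empty
   index type. *)
exists 1%N, 0%N, (fun=> fun p => Pmax^-1 * \sum_l p l 0), (fun=> fun=> 1).
split=> [_|[]//|p].
  apply: posynomialM; first by apply: posynomial_const; rewrite invr_ge0 ltW.
  by apply: posynomial_sum => l; apply: posynomial_var.
have -> : (\sum_l p l 0 <= Pmax) = (Pmax^-1 * \sum_l p l 0 <= 1).
  by rewrite mulrC ler_pdivrMr ?mul1r.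
by split=> [[]|[? /(_ ord0) ? _]]; split=> // -[].
Qed.

End Posynomials.

(** * Positive matrices and Hermitian forms *)

Section Hermitian.
Variable R : realType.
Local Notation C := R[i].

Lemma adjmxE m n (A : 'M[C]_(m, n)) i j : A ^t* i j = (A j i)^*%R.
Proof. by rewrite !mxE. Qed.

Lemma norm2_sqr n (v : 'cV[C]_n) : norm2 v ^+ 2 = (v ^t* *m v) 0 0.
Proof.
rewrite sqrtCK mxE; apply: eq_bigr => i _.
by rewrite adjmxE normCK mulrC.
Qed.

Lemma norm2_ge0 n (v : 'cV[C]_n) : 0 <= norm2 v.
Proof. by rewrite sqrtC_ge0 sumr_ge0 // => i _; rewrite exprn_ge0. Qed.

(** The square root X is Hermitian, so the squared norm of X v is v^H X X v. This removes every
    matrix square root from the computation. *)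
Lemma norm2_sqrtmx n (A : 'M[C]_n) (v : 'cV[C]_n) :
  psdmx A -> norm2 (sqrtmx A *m v) ^+ 2 = (v ^t* *m A *m v) 0 0.
Proof.
move=> /sqrtmxP[[hX _] eX].
by rewrite norm2_sqr adjmxM hX mulmxA -[_ *m _ *m sqrtmx A]mulmxA eX.
Qed.

(** A nonzero row v with v A = 0 would make the form vanish at the nonzero column v^H. *)
Lemma pdmx_unit n (A : 'M[C]_n) : pdmx A -> A \in unitmx.
Proof.
case=> _ A_gt0; rewrite unitmxE unitfE; apply/det0P => -[v v_neq0 vA].
have := A_gt0 (v ^t*); rewrite trmxCK vA mul0mx mxE ltxx => /(_ _)/negP; apply=> //.
by apply: contra_neq v_neq0 => v0; rewrite -[v]trmxCK v0 trmx0 map_mx0.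
Qed.

(** With y = A^{-1} x, the form of A^{-1} at x is the form of A at y. *)
Lemma pdmx_inv_psd n (A : 'M[C]_n) : pdmx A -> psdmx (invmx A).
Proof.
move=> pdA; have uA := pdmx_unit pdA; have [hA A_gt0] := pdA.
have hA' : (invmx A) ^t* = invmx A by rewrite trmx_inv map_invmx hA.
split=> // x.
have -> : x ^t* *m invmx A *m x = (invmx A *m x) ^t* *m A *m (invmx A *m x).
  by rewrite adjmxM hA' -(mulmxA (x ^t*) _ A) mulVmx // mulmx1 mulmxA.
have [->|y_neq0] := eqVneq (invmx A *m x) 0; first by rewrite mulmx0 mxE.
exact/ltW/A_gt0.
Qed.

Lemma psdmxZ n (a : C) (A : 'M[C]_n) : 0 <= a -> psdmx A -> psdmx (a *: A).
Proof.
move=> a_ge0 [hA A_ge0]; split=> [|x].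
  by rewrite linearZ /= map_mxZ hA; congr (_ *: _); apply/CrealP/ger0_real.
by rewrite -scalemxAr -scalemxAl mxE mulr_ge0.
Qed.

Lemma pdmx1D n (A : 'M[C]_n) : psdmx A -> pdmx (1%:M + A).
Proof.
case=> hA A_ge0; split=> [|x x_neq0].
  by rewrite linearD /= map_mxD hA tr_scalar_mx map_scalar_mx rmorph1.
rewrite mulmxDr mulmx1 mulmxDl mxE ltr_wpDr // lt_neqAle.
rewrite (_ : 0 <= _) ?andbT; last first.
  by rewrite mxE sumr_ge0 // => i _; rewrite adjmxE mulrC mul_conjC_ge0.
(* The product x^H x is a 1 by 1 matrix, hence its entry is its trace and [adjM_eq0] applies. *)
rewrite eq_sym; apply: contra_neq x_neq0 => xx0; apply: adjM_eq0.
by rewrite /mxtrace big_ord1.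
Qed.

Lemma mul_ReJ (a h : C) :
  2 * a * (complex.Re h^*%R)%:C = a * (h + h^*%R).
Proof.
have <- : 2 * (complex.Re h^*%R)%:C = h + h^*%R.
  by rewrite -(addcJ (conjc h)) conjcK addrC.
by rewrite mulrCA mulrA.
Qed.

(* The right-hand side exhibits the diagonal entries of D as nonnegative. *)
Lemma distance_expand (a : R) (h : C) :
  a%:C ^+ 2 * `|h| ^+ 2 - 2 * a%:C * (complex.Re h^*%R)%:C + 1
    = `|a%:C * h - 1| ^+ 2.
Proof.
rewrite mul_ReJ.
have ea : (a%:C)^*%R = a%:C by apply: conjc_real.
by rewrite !normCK rmorphB rmorphM rmorph1 /= ea; ring.
Qed.

Lemma adjmxZ m n (a : R) (A : 'M[C]_(m, n)) :
  (a%:C *: A) ^t* = a%:C *: A ^t*.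
Proof. by rewrite linearZ /= map_mxZ; congr (_ *: _); apply: conjc_real. Qed.

(** Real scalars are fixed by conjugation, so filter scalings leave both sides of a sesquilinear
    form as a plain product. *)
Lemma bilinearZ m n (a c : R) (A : 'M[C]_(m, n)) (u : 'cV[C]_m) (v : 'cV[C]_n) :
  ((a%:C *: u) ^t* *m A *m (c%:C *: v)) 0 0 = (a * c)%:C * (u ^t* *m A *m v) 0 0.
Proof.
rewrite adjmxZ -!scalemxAl -scalemxAr scalerA -rmorphM.
by rewrite [LHS]mxE.
Qed.

End Hermitian.

(** * Block diagonal receive filters *)

Section Blocks.
Variables (R : realType) (K : nat) (M S : 'I_K -> nat).
Local Notation C := R[i].

Lemma mul_mxrow_blkdiag N (H : forall k, 'M[C]_(N, M k))
    (U : forall k, 'M[C]_(M k, S k)) :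
  \mxrow_k H k *m blkdiag U = \mxrow_k (H k *m U k).
Proof.
rewrite mul_mxrow_mxblock; apply: eq_mxrow => k.
rewrite (bigD1 k) //= eqxx conform_mx_id big1 ?addr0 // => i /negPf->.
by rewrite mulmx0.
Qed.

(** Column l of [blkdiag U] vanishes outside the block of user f(l), so only that diagonal block of
    the middle matrix contributes. *)
Lemma blkdiag_quadratic (A : forall k, 'M[C]_(M k))
    (U : forall k, 'M[C]_(M k, S k)) l :
  (col l (blkdiag U)) ^t* *m (\mxdiag_k A k) *m col l (blkdiag U)
    = (ublock U l) ^t* *m A (tagnat.sig1 l) *m ublock U l.
Proof.
pose k := tagnat.sig1 l.
pose v i : 'cV[C]_(M i) :=
  col (tagnat.sig2 l) (if i == k then conform_mx 0 (U i) else 0).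
have -> : col l (blkdiag U) = \mxcol_i v i.
  by apply/colP => i; rewrite !mxE.
have -> : (\mxcol_i v i) ^t* = \mxrow_i (v i) ^t*.
  by apply/rowP => i; rewrite !mxE.
rewrite mul_mxrow_mxdiag mul_mxrow_mxcol (bigD1 k) //= big1 ?addr0 => [|i].
  by rewrite /v eqxx conform_mx_id.
by rewrite /v => /negPf->; rewrite col0 mulmx0.
Qed.

End Blocks.

(** * Expansion of the AMSE over the columns of the filters *)

Section MSE.
Variables (R : realType) (N K : nat) (M S : 'I_K -> nat).
Variable ch : channel R N M.
Local Notation C := R[i].

Lemma quadratic_entry m n p q (A : 'M[C]_(m, p)) (X : 'M[C]_(m, n))
    (B : 'M[C]_(n, q)) i j :
  (A ^t* *m X *m B) i j = ((col i A) ^t* *m X *m col j B) 0 0.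
Proof.
rewrite !mxE; apply: eq_bigr => s _; rewrite !mxE; congr (_ * _).
by apply: eq_bigr => t _; rewrite !mxE.
Qed.

(** Inversion, scaling by a nonnegative real and addition of the identity all preserve positivity.
    Hence [sqrtmx (Rm ch k)] is a genuine square root. *)
Lemma psdmx_Rm k : 0 <= sigma2 ch k -> pdmx (Rmt ch k) -> psdmx (Rm ch k).
Proof.
move=> s_ge0 pdR; apply/pdmx_inv_psd/pdmx1D/psdmxZ; first by rewrite ler0c.
exact: pdmx_inv_psd.
Qed.

(** Since B B^H is the sum of the b_j b_j^H, both the received power and the estimation error split
    into contributions of single symbols. *)
Lemma GammaDL_quadratic (B : forall k, 'M[C]_(N, S k)) k (w : 'cV[C]_(M k)) :
  let b j := col j (\mxrow_k B k) in
  (w ^t* *m GammaDL ch B k *m w) 0 0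
    = \sum_j (`|((b j) ^t* *m Hhat ch k *m w) 0 0| ^+ 2
              + (sigma2 ch k)%:C * (w ^t* *m Rm ch k *m w) 0 0
                * ((b j) ^t* *m Rb ch k *m b j) 0 0)
      + (w ^t* *m Rn ch k *m w) 0 0.
Proof.
rewrite /GammaDL /=; set Bf := \mxrow_j B j; set H := Hhat ch k.
rewrite !mulmxDr !mulmxDl mxE [X in X + _]mxE big_split /=; congr (_ + _ + _).
  (* The received power is y^H y, and the entry of y at j is b_j^H H w. *)
  pose y := Bf ^t* *m H *m w.
  have -> : w ^t* *m (H ^t* *m Bf *m Bf ^t* *m H) *m w = y ^t* *m y.
    by rewrite /y !adjmxM trmxCK !mulmxA.
  rewrite mxE; apply: eq_bigr => j _; rewrite adjmxE normCK mulrC.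
  have -> : y j 0 = ((col j Bf) ^t* *m H *m w) 0 0; last by [].
  by rewrite /y quadratic_entry; congr ((_ *m _) _ _); apply/colP => i; rewrite mxE.
rewrite -scalemxAr -scalemxAl mxE mulrAC -mulr_sumr; congr (_ * _ * _).
(* By cyclicity the trace is that of B^H R_b B, whose diagonal entries are b_j^H R_b b_j. *)
rewrite mxtrace_mulC mulmxA /mxtrace; apply: eq_bigr => j _.
exact: quadratic_entry.
Qed.

Lemma amse_quadratic (B : forall k, 'M[C]_(N, S k))
    (W : forall k, 'M[C]_(M k, S k)) l :
  let k := tagnat.sig1 l in
  let b := col l (\mxrow_k B k) in
  let w := ublock W l in
  amse ch B W l
    = 1 + (w ^t* *m GammaDL ch B k *m w) 0 0
      - (w ^t* *m (Hhat ch k) ^t* *m b) 0 0 - (b ^t* *m Hhat ch k *m w) 0 0.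
Proof.
rewrite /= col_mxrow /amse /amse_mx.
set k := tagnat.sig1 l; set t := tagnat.sig2 l.
rewrite ![fun_of_matrix (_ + _) _ _]mxE ![fun_of_matrix (- _) _ _]mxE.
by rewrite /ublock -!quadratic_entry [1%:M t t]mxE eqxx.
Qed.

(** * Substitution of the scaled unit filters *)

Section Decomposition.
Variables (G : 'M[C]_(N, \sum_k S k)) (U : forall k, 'M[C]_(M k, S k)).
Variables (alpha : 'I_(\sum_k S k) -> R) (p : 'cV[R]_(\sum_k S k)).

Lemma col_precoder l :
  col l (\mxrow_k precoder G p k) = (p l 0 `^ 2^-1)%:C *: col l G.
Proof.
rewrite submxrowK; apply/colP => i.
by rewrite /diagpow mul_mx_diag !mxE mulrC.
Qed.

Lemma ublock_decoder l :
  ublock (decoder U alpha p) l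
    = (alpha l * p l 0 `^ (- 2^-1))%:C *: ublock U l.
Proof.
apply/colP => i; rewrite /ublock mxE /decoder /alphamx /diagpow -mulmxA mulmx_diag mul_mx_diag.
rewrite mxE [LHS]mxE tagnat.sig2K [RHS]mxE mulrC !mxE rmorphM; congr (_ * _).
set k := tagnat.sig1 l.
(* Reading the entry through a diagonal block makes [conform_mx] act as the identity. *)
transitivity (submxblock (blkdiag U) k k i (tagnat.sig2 l)).
  by rewrite [RHS]mxE tagnat.sig2K [RHS]mxE.
by rewrite /blkdiag mxblockK eqxx conform_mx_id.
Qed.

(** Passes from the stacked channel of the statement to the channel of the user who owns symbol
    l. *)
Lemma Hfull_blkdiag l :
  Hfull ch *m col l (blkdiag U) = Hhat ch (tagnat.sig1 l) *m ublock U l.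
Proof.
by rewrite colE mulmxA mul_mxrow_blkdiag -colE col_mxrow /ublock !colE mulmxA.
Qed.

Hypothesis Rb_psd : forall k, psdmx (Rb ch k).
Hypothesis Rm_psd : forall k, psdmx (Rm ch k).

Lemma couplingE l j :
  let k := tagnat.sig1 j in
  coupling ch G U l j
    = `|((col l G) ^t* *m Hhat ch k *m ublock U j) 0 0| ^+ 2
      + (sigma2 ch k)%:C * ((ublock U j) ^t* *m Rm ch k *m ublock U j) 0 0
        * ((col l G) ^t* *m Rb ch k *m col l G) 0 0.
Proof. by rewrite /= /coupling !norm2_sqrtmx // -!mulmxA Hfull_blkdiag. Qed.

Lemma estimation_error_ge0 l j : 0 <= sigma2 ch (tagnat.sig1 j) ->
  0 <= (sigma2 ch (tagnat.sig1 j))%:C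
       * norm2 (sqrtmx (Rm ch (tagnat.sig1 j)) *m ublock U j) ^+ 2
       * norm2 (sqrtmx (Rb ch (tagnat.sig1 j)) *m col l G) ^+ 2.
Proof. by move=> s_ge0; rewrite !mulr_ge0 ?ler0c ?exprn_ge0 ?norm2_ge0. Qed.

Lemma coupling_ge0 l j :
  0 <= sigma2 ch (tagnat.sig1 j) -> 0 <= coupling ch G U l j.
Proof. by move=> s_ge0; rewrite addr_ge0 ?exprn_ge0 ?estimation_error_ge0. Qed.

(** This is the effective scalar channel of symbol l between its own transmit and receive
    filters. *)
Definition gain l : C := ((col l G) ^t* *m Hfull ch *m col l (blkdiag U)) 0 0.

Lemma gain_conj l :
  ((col l (blkdiag U)) ^t* *m (Hfull ch) ^t* *m col l G) 0 0 = (gain l)^*%R.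
Proof. by rewrite -adjmxE !adjmxM trmxCK mulmxA. Qed.

Lemma amse_decomposition l : pos_orthant p ->
  amse ch (precoder G p) (decoder U alpha p) l
    = (p l 0)^-1%:C * (alpha l)%:C ^+ 2
        * (\sum_j (p j 0)%:C * coupling ch G U j l
           + ((ublock U l) ^t* *m Rn ch (tagnat.sig1 l) *m ublock U l) 0 0)
      + 1 - 2 * (alpha l)%:C * (complex.Re (gain l)^*%R)%:C.
Proof.
move=> p_gt0; set k := tagnat.sig1 l.
(* These are the scalars with w_l = c u_l and b_j = s_j g_j. Then s_l c = alpha_l, which frees the
   cross terms of powers, while c^2 = alpha_l^2 / p_l multiplies all quadratic terms. *)
pose c := alpha l * p l 0 `^ (- 2^-1); pose s j := p j 0 `^ 2^-1.
have s2 j : s j ^+ 2 = p j 0 by rewrite /s powR12_sqrt ?sqr_sqrtr // ltW.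
have s_neq0 j : s j != 0 by rewrite gt_eqF // powR_gt0.
have cE : c = alpha l / s l by rewrite /c powRN.
have c2 : c ^+ 2 = alpha l ^+ 2 / p l 0 by rewrite cE expr_div_n s2.
have sc : s l * c = alpha l by rewrite cE mulrC divfK.
have cs : c * s l = alpha l by rewrite mulrC.
rewrite amse_quadratic GammaDL_quadratic !col_precoder !ublock_decoder.
rewrite -/c -/(s l) -/k (bilinearZ c c (Rn ch k) (ublock U l)).
rewrite [X in _ - X = _]bilinearZ [X in _ - X - _ = _]bilinearZ -expr2 sc cs.
have -> : (p l 0)^-1%:C * (alpha l)%:C ^+ 2 = (c ^+ 2)%:C.
  by rewrite c2 mulrC rmorphM rmorphXn.
rewrite (eq_bigr (fun j => (c ^+ 2)%:C * ((p j 0)%:C * coupling ch G U j l)));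
    last first.
  move=> j _; rewrite col_precoder -/(s j) couplingE -/k.
  rewrite (bilinearZ (s j) c (Hhat ch k) (col j G) (ublock U l)).
  rewrite (bilinearZ c c (Rm ch k) (ublock U l)).
  rewrite (bilinearZ (s j) (s j) (Rb ch k) (col j G)).
  rewrite -!expr2 s2 normrM exprMn.
  have -> : `|(s j * c)%:C| ^+ 2 = (p j 0)%:C * (c ^+ 2)%:C.
    rewrite real_normK; last by apply/complex_realP; exists (s j * c).
    by rewrite -rmorphXn exprMn s2 rmorphM.
  ring.
rewrite -mulr_sumr mulrDr.
have -> : ((col l G) ^t* *m Hhat ch k *m ublock U l) 0 0 = gain l.
  by rewrite /gain -[in RHS]mulmxA Hfull_blkdiag mulmxA.
have -> : ((ublock U l) ^t* *m (Hhat ch k) ^t* *m col l G) 0 0 = (gain l)^*%R.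
  by rewrite -gain_conj -!adjmxM Hfull_blkdiag.
rewrite mul_ReJ.
ring.
Qed.

(** * Coefficients of the AMSE as a function of the powers *)

(** Entry (l, j) is the coefficient of p_j / p_l in the AMSE of symbol l. The transpose appears
    because [coupling j l] measures what symbol j causes at the receiver of l. *)
Definition mse_mx : 'M[C]_(\sum_k S k) :=
  Dmx ch G U alpha + alphamx alpha *m alphamx alpha *m (Phimx ch G U)^T.

(** The self-coupling contained in D fills the zero diagonal of Phi, so the coupling term becomes
    uniform in j and only a diagonal correction remains. *)
Lemma mse_mxE l j :
  mse_mx l j = (alpha l)%:C ^+ 2 * coupling ch G U j l
    + (1 - 2 * (alpha l)%:C * (complex.Re (gain l)^*%R)%:C) *+ (l == j).
Proof.
rewrite /mse_mx.
have -> : Dmx ch G U alpha = diag_mx (\row_i ((alpha i)%:C ^+ 2 * coupling ch G U i i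
    - 2 * (alpha i)%:C * (complex.Re (gain i)^*%R)%:C + 1)).
  by congr diag_mx; apply/rowP => i; rewrite [LHS]mxE [RHS]mxE gain_conj.
rewrite mulmx_diag mul_diag_mx !mxE -expr2.
case: (eqVneq l j) => [<-|_].
  by rewrite !mulr1n mulr0 addr0 -addrA [- _ + 1]addrC.
by rewrite !mulr0n add0r addr0.
Qed.

Lemma mse_mx_ge0 l j : 0 <= sigma2 ch (tagnat.sig1 l) -> 0 <= mse_mx l j.
Proof.
move=> s_ge0; rewrite mse_mxE; case: eqVneq => [<-|_]; last first.
  by rewrite addr0 mulr_ge0 ?coupling_ge0 // -rmorphXn ler0c sqr_ge0.
have := estimation_error_ge0 l s_ge0; rewrite /coupling -/(gain l) mulr1n.
(* Once the estimation error [e] is set apart, the rest of the diagonal entry is the perfect square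
   of [distance_expand]. *)
set e := (_ * norm2 _ ^+ 2) => e_ge0.
have -> : (alpha l)%:C ^+ 2 * (`|gain l| ^+ 2 + e)
            + (1 - 2 * (alpha l)%:C * (complex.Re (gain l)^*%R)%:C)
          = `|(alpha l)%:C * gain l - 1| ^+ 2 + (alpha l)%:C ^+ 2 * e.
  by rewrite -distance_expand; ring.
by rewrite addr_ge0 ?exprn_ge0 // mulr_ge0 // -rmorphXn ler0c sqr_ge0.
Qed.

Definition noise l : C :=
  ((ublock U l) ^t* *m Rn ch (tagnat.sig1 l) *m ublock U l) 0 0.

Lemma amse_mse_mx l : pos_orthant p ->
  amse ch (precoder G p) (decoder U alpha p) l
    = (p l 0)^-1%:C * (mse_mx *m map_mx (real_complex R) p) l 0
      + (p l 0)^-1%:C * (alpha l)%:C ^+ 2 * noise l.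
Proof.
move=> p_gt0; rewrite amse_decomposition // -/(noise l).
have -> : (mse_mx *m map_mx (real_complex R) p) l 0
  = (alpha l)%:C ^+ 2 * (\sum_j (p j 0)%:C * coupling ch G U j l)
    + (1 - 2 * (alpha l)%:C * (complex.Re (gain l)^*%R)%:C) * (p l 0)%:C.
  rewrite mxE mulr_sumr.
  set z := 1 - _; transitivity (\sum_j ((alpha l)%:C ^+ 2
      * ((p j 0)%:C * coupling ch G U j l) + (z *+ (l == j)) * (p j 0)%:C)).
    apply: eq_bigr => j _; rewrite mse_mxE mxE mulrDl; congr (_ + _).
    by rewrite mulrAC mulrA.
  rewrite big_split /=; congr (_ + _).
  rewrite (bigD1 l) //= eqxx [X in _ + X]big1 ?addr0 // => j /negPf jl.
  by rewrite eq_sym jl mul0r.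
(* The constant and cross terms carry no power; multiplying them by p_l^{-1} p_l = 1 turns them into
   the diagonal correction. *)
have pVp : (p l 0)^-1%:C * (p l 0)%:C = 1 by rewrite -rmorphM mulVf ?gt_eqF.
rewrite -addrA -[X in _ + X]mulr1 -pVp; ring.
Qed.

(** Every coefficient is nonnegative in [R[i]], hence real. Writing the AMSE as an embedded real
    number yields both its zero imaginary part and the expression to be shown a posynomial. *)
Lemma amse_real l : pos_orthant p -> (forall k, 0 <= sigma2 ch k) ->
    (forall k, psdmx (Rn ch k)) ->
  amse ch (precoder G p) (decoder U alpha p) l
    = ((p l 0)^-1 * (\sum_j complex.Re (mse_mx l j) * p j 0
                     + alpha l ^+ 2 * complex.Re (noise l)))%:C.
Proof.
move=> p_gt0 s_ge0 Rn_psd.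
have ReK (z : C) : 0 <= z -> z = (complex.Re z)%:C.
  by move=> z_ge0; rewrite RRe_real ?ger0_real.
rewrite amse_mse_mx // -mulrA -mulrDr rmorphM rmorphD rmorphM rmorphXn /=.
rewrite -ReK; last by have [_] := Rn_psd (tagnat.sig1 l); apply.
congr (_ * (_ + _)); rewrite mxE rmorph_sum; apply: eq_bigr => j _ /=.
by rewrite [X in _ * X]mxE rmorphM /= -ReK // mse_mx_ge0.
Qed.

End Decomposition.
End MSE.


Theorem mainTheorem5 (R : realType) (N K : nat) (M S : 'I_K -> nat)
    (hN : (0 < N)%N) (hK : (0 < K)%N)
    (hM : forall k, (0 < M k)%N) (hS : forall k, (0 < S k)%N)
    (ch : channel R N M)
    (hsigma2 : forall k, 0 <= sigma2 ch k)
    (hRb : forall k, psdmx (Rb ch k))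
    (hRn : forall k, psdmx (Rn ch k))
    (hRmt : forall k, pdmx (Rmt ch k))
    (G : 'M[R[i]]_(N, \sum_k S k)) (U : forall k, 'M[R[i]]_(M k, S k))
    (alpha : 'I_(\sum_k S k) -> R)
    (hG : forall l, norm2 (col l G) = 1)
    (hU : forall l, norm2 (col l (blkdiag U)) = 1) :
  let xi (p : 'cV[R]_(\sum_k S k)) (l : 'I_(\sum_k S k)) : R[i] :=
    amse ch (precoder G p) (decoder U alpha p) l in
  (forall p, pos_orthant p -> forall l,
     xi p l =
       (p l 0)^-1%:C
         * ((Dmx ch G U alpha
             + alphamx alpha *m alphamx alpha *m (Phimx ch G U)^T)
            *m map_mx (real_complex R) p) l 0
       + (p l 0)^-1%:C * (alpha l)%:C ^+ 2
         * ((col l (blkdiag U)) ^t* *m Rnfull ch *m col l (blkdiag U)) 0 0)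
  /\ (forall l,
        (forall p, pos_orthant p -> complex.Im (xi p l) = 0) /\
        posynomial (fun p => complex.Re (xi p l)))
  /\ (forall Pmax : R, 0 < Pmax ->
        geometric_program
          (MinProblem (fun p => complex.Re (\sum_l xi p l))
                      (fun p => pos_orthant p /\ \sum_l p l 0 <= Pmax))).
Proof.
move=> xi.
have Rm_psd k : psdmx (Rm ch k) by apply: psdmx_Rm.
have Re_posy l : posynomial (fun p => complex.Re (xi p l)).
  pose f (p : 'cV[R]_(\sum_k S k)) :=
    (p l 0)^-1 * (\sum_j complex.Re (mse_mx ch G U alpha l j) * p j 0
                  + alpha l ^+ 2 * complex.Re (noise ch U l)).
  apply: (@posynomial_ext _ _ _ f) => [p p_gt0|]; first by rewrite /xi amse_real.
  have Re_ge0 (z : R[i]) : 0 <= z -> 0 <= complex.Re z by rewrite lecE => /andP[].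
  apply: posynomialM; first exact: posynomial_inv.
  apply: posynomialD; last first.
    apply: posynomial_const; rewrite mulr_ge0 ?sqr_ge0 // Re_ge0 //.
    by have [_] := hRn (tagnat.sig1 l); apply.
  apply: posynomial_sum => j; apply: posynomialM; last exact: posynomial_var.
  by apply/posynomial_const/Re_ge0/mse_mx_ge0.
split; last split.
- by move=> p p_gt0 l; rewrite /xi amse_mse_mx // blkdiag_quadratic.
- by move=> l; split=> // p p_gt0; rewrite /xi amse_real.
- move=> Pmax Pmax_gt0; apply: power_budget_geometric_program => //.
  apply: posynomial_ext (posynomial_sum (index_enum _) Re_posy) => p _.
  (* Additivity of [Re] is taken over [Rcomplex R], the complex numbers regarded as a real vector
     space. *)
  exact: (raddf_sum (@complex.Re R : Rcomplex R -> R)).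
Qed.
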